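(* Consider an iteration $t$ of the full-data GROUSE algorithm described in the context. Suppose that $v_t=\bar Us_t$, where the components of $s_t\in\mathbb R^d$ are chosen i.i.d. from $\mathcal N(0,1)$, and that for each $t$ $$\eta_t=\frac{\theta_t}{\sigma_t}=\frac{2\theta_t}{\|v_t\|^2\sin2\theta_t}.$$ Suppose too that $\epsilon_t\le\bar\epsilon$ for some $\bar\epsilon\in(0,1/3)$. Then $$E[\epsilon_{t+1}\mid\epsilon_t]\le\left(1-\frac{1-3\epsilon_t}{d}\right)\epsilon_t.$$
   Context: Let $0<d<n$ be integers and let $\bar U\in\mathbb R^{n\times d}$ have orthonormal columns spanning the target subspace $\mathcal S$. For $U_t\in\mathbb R^{n\times d}$ with orthonormal columns, $\epsilon_t:=d-\|\bar U^TU_t\|_F^2=\sum_{i=1}^d\sin^2\phi_i$, where $\cos\phi_i$ are the singular values of $\bar U^TU_t$. $\|\cdot\|$ is the Euclidean norm. Full-data GROUSE iteration: given $U_t$ with orthonormal columns, take $v_t\in\mathcal S$; set $w_t:=\arg\min_w\|U_tw-v_t\|_2^2=U_t^Tv_t$, $p_t:=U_tw_t$, $r_t:=v_t-p_t$, $\sigma_t:=\|r_t\|\,\|p_t\|$; choose $\eta_t>0$ and set $$U_{t+1}:=U_t+\left[(\cos(\sigma_t\eta_t)-1)\frac{p_t}{\|p_t\|}+\sin(\sigma_t\eta_t)\frac{r_t}{\|r_t\|}\right]\frac{w_t^T}{\|w_t\|}.$$ The angle $\theta_t\in[0,\pi/2]$ between $v_t$ and $R(U_t)$ (the range of $U_t$)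 is given by $\cos\theta_t=\|p_t\|/\|v_t\|$, $\sin\theta_t=\|r_t\|/\|v_t\|$, so that $\sigma_t=\frac12\|v_t\|^2\sin2\theta_t$. In the degenerate case $\sigma_t=0$ (i.e. $r_t=0$ or $p_t=0$), $U_{t+1}=U_t$. The vectors $s_t$ are drawn independently across iterations, and the conditional expectation is over the draw of $s_t$ with the current iterate $U_t$ given. *)

(* Defs.v *)
From HB Require Import structures.
From mathcomp Require Import all_boot all_order all_algebra.
From mathcomp Require Import all_classical all_reals all_analysis.
From mathcomp Require Import ring lra.

Set Implicit Arguments.
Unset Strict Implicit.
Unset Printing Implicit Defensive.

Import Order.TTheory GRing.Theory Num.Theory.

Local Open Scope classical_set_scope.
Local Open Scope ring_scope.

(* The library norm on matrices is the max norm, hence the explicit Euclidean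
   (Frobenius) norm. *)
Definition frobenius_norm (R : realType) (m n : nat) (A : 'M[R]_(m, n)) : R :=
  Num.sqrt (\sum_i \sum_j A i j ^+ 2).

Definition euclidean_norm (R : realType) (n : nat) (x : 'cV[R]_n) : R :=
  Num.sqrt (\sum_i x i 0 ^+ 2).

Definition orthonormal_columns (R : realType) (n d : nat) (U : 'M[R]_(n, d)) :=
  U^T *m U = 1%:M.

Definition subspace_error (R : realType) (n d : nat) (Ubar U : 'M[R]_(n, d)) : R :=
  d%:R - frobenius_norm (Ubar^T *m U) ^+ 2.

Section Grouse.
Variables (R : realType) (n d : nat) (U : 'M[R]_(n, d)) (v : 'cV[R]_n).

(* The least-squares weight argmin_w |U w - v|, see [grouse_weight_argmin]. *)
Definition grouse_weight : 'cV[R]_d := U^T *m v.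

Definition grouse_projection : 'cV[R]_n := U *m grouse_weight.

Definition grouse_residual : 'cV[R]_n := v - grouse_projection.

Definition grouse_sigma : R :=
  euclidean_norm grouse_residual * euclidean_norm grouse_projection.

(* The angle between v and the range of U; irrelevant when v = 0, where the
   step below is degenerate. *)
Definition grouse_angle : R :=
  acos (euclidean_norm grouse_projection / euclidean_norm v).

Definition grouse_step (eta : R) : 'M[R]_(n, d) :=
  let w := grouse_weight in
  let p := grouse_projection in
  let r := grouse_residual in
  let sigma := grouse_sigma in
  if sigma == 0 then U
  else U + (((cos (sigma * eta) - 1) / euclidean_norm p) *: p
            + (sin (sigma * eta) / euclidean_norm r) *: r)
           *m ((euclidean_norm w)^-1 *: w^T).

End Grouse.

Section IndependentNormal.
Context {d : measure_display} {T : measurableType d} {R : realType}.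
Variables (P : probability T R) (I : finType) (X : I -> {RV P >-> R}).

Definition mutually_independent : Prop :=
  forall (J : {set I}) (B : I -> set R),
    (forall i, measurable (B i)) ->
    P (\bigcap_(i in [set` J]) (X i @^-1` B i)) =
    (\prod_(i in J) P (X i @^-1` B i))%E.

(* The second parameter of [normal_prob] is the standard deviation. *)
Definition iid_standard_normal : Prop :=
  mutually_independent /\
  forall i (B : set R), measurable B ->
    distribution P (X i) B = normal_prob 0 1 B.

End IndependentNormal.

Section EuclideanNorm.
Variables (R : realType) (n : nat).
Implicit Types x y : 'cV[R]_n.

Lemma euclidean_norm_ge0 x : 0 <= euclidean_norm x.
Proof. exact: sqrtr_ge0. Qed.

Lemma sqr_euclidean_norm x : euclidean_norm x ^+ 2 = (x^T *m x) 0 0.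
Proof.
rewrite sqr_sqrtr ?sumr_ge0// => [|i _]; last exact: sqr_ge0.
by rewrite mxE; apply: eq_bigr => i _; rewrite !mxE expr2.
Qed.

Lemma euclidean_norm_eq0 x : euclidean_norm x = 0 -> x = 0.
Proof.
move=> /eqP; rewrite sqrtr_eq0 => x0; apply/colP => i; rewrite mxE.
have s0 : \sum_j x j 0 ^+ 2 == 0.
  by rewrite eq_le x0 sumr_ge0// => j _; exact: sqr_ge0.
move: s0; rewrite psumr_eq0; last by move=> j _; exact: sqr_ge0.
by move/allP/(_ i (mem_index_enum _)); rewrite sqrf_eq0 => /eqP.
Qed.

Lemma pythagoras x y : x^T *m y = 0 ->
  euclidean_norm (x + y) ^+ 2 = euclidean_norm x ^+ 2 + euclidean_norm y ^+ 2.
Proof.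
move=> xy; have yx : y^T *m x = 0.
  by apply: trmx_inj; rewrite trmx_mul trmxK xy trmx0.
by rewrite !sqr_euclidean_norm [(x + y)^T]raddfD/= mulmxDr !mulmxDl xy yx addr0 add0r mxE.
Qed.

End EuclideanNorm.

Section GrouseFacts.
Variables (R : realType) (n d : nat) (U : 'M[R]_(n, d)) (v : 'cV[R]_n).
Hypothesis hU : orthonormal_columns U.

Local Notation w := (grouse_weight U v).
Local Notation p := (grouse_projection U v).
Local Notation r := (grouse_residual U v).
Local Notation theta := (grouse_angle U v).

Lemma grouse_residual_orthogonal : U^T *m r = 0.
Proof.
by rewrite /grouse_residual mulmxBr /grouse_projection mulmxA hU mul1mx subrr.
Qed.

Lemma grouse_weight_argmin (x : 'cV[R]_d) :
  euclidean_norm (U *m w - v) <= euclidean_norm (U *m x - v) ?= iff (x == w).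
Proof.
have E y : euclidean_norm (U *m y - v) ^+ 2 =
    euclidean_norm (y - w) ^+ 2 + euclidean_norm r ^+ 2.
  have -> : U *m y - v = U *m (y - w) + - r.
    by rewrite mulmxBr /grouse_residual opprB addrA subrK.
  rewrite pythagoras; last first.
    by rewrite mulmxN trmx_mul -mulmxA grouse_residual_orthogonal mulmx0 oppr0.
  by rewrite !sqr_euclidean_norm trmx_mul -mulmxA (mulmxA U^T) hU mul1mx
    [(- r)^T]raddfN/= mulmxN mulNmx opprK.
have e0 : euclidean_norm (w - w) = 0.
  by rewrite subrr /euclidean_norm big1 ?sqrtr0// => i _; rewrite mxE expr0n.
have le (y z : 'cV[R]_n) : (euclidean_norm y <= euclidean_norm z) =
    (euclidean_norm y ^+ 2 <= euclidean_norm z ^+ 2).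
  by rewrite ler_sqr ?nnegrE ?euclidean_norm_ge0.
split; first by rewrite le !E e0 expr0n add0r lerDr sqr_ge0.
apply/eqP/eqP => [h|->//].
have := E x; rewrite -h E e0 expr0n add0r => /eqP.
rewrite -subr_eq0 opprD addrCA subrr addr0 oppr_eq0 sqrf_eq0 => /eqP.
by move=> /euclidean_norm_eq0 /eqP; rewrite subr_eq0 => /eqP.
Qed.

Lemma grouse_pythagoras :
  euclidean_norm v ^+ 2 = euclidean_norm p ^+ 2 + euclidean_norm r ^+ 2.
Proof.
rewrite -pythagoras; first by rewrite /grouse_residual addrC subrK.
by rewrite trmx_mul -mulmxA grouse_residual_orthogonal mulmx0.
Qed.

Hypothesis hv : v != 0.

Let nv0 : 0 < euclidean_norm v.
Proof.
rewrite lt_neqAle euclidean_norm_ge0 andbT eq_sym; apply: contra hv => /eqP.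
by move=> /euclidean_norm_eq0 ->.
Qed.

Let cos_ge0 : 0 <= euclidean_norm p / euclidean_norm v.
Proof. by rewrite divr_ge0// ?euclidean_norm_ge0. Qed.

Let cos_itv : -1 <= euclidean_norm p / euclidean_norm v <= 1.
Proof.
rewrite (le_trans _ cos_ge0) ?lerN10//= ler_pdivrMr// mul1r.
rewrite -ler_sqr ?nnegrE ?euclidean_norm_ge0//.
by rewrite grouse_pythagoras lerDl sqr_ge0.
Qed.

Lemma cos_grouse_angle : cos theta = euclidean_norm p / euclidean_norm v.
Proof. by rewrite acosK. Qed.

Lemma sin_grouse_angle : sin theta = euclidean_norm r / euclidean_norm v.
Proof.
rewrite sin_acos//.
have -> : 1 - (euclidean_norm p / euclidean_norm v) ^+ 2 =
    (euclidean_norm r / euclidean_norm v) ^+ 2.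
  rewrite !expr_div_n; apply: (@mulIf _ (euclidean_norm v ^+ 2)).
    by rewrite expf_neq0// gt_eqF.
  by rewrite mulrBl !divfK ?expf_neq0 ?gt_eqF// mul1r grouse_pythagoras addrC addKr.
by rewrite sqrtr_sqr ger0_norm// divr_ge0// euclidean_norm_ge0.
Qed.

Lemma grouse_sigmaE :
  grouse_sigma U v = euclidean_norm v ^+ 2 * sin (2 * theta) / 2.
Proof.
rewrite mulr_natl sin_mulr2n cos_grouse_angle sin_grouse_angle /grouse_sigma.
by field; rewrite gt_eqF.
Qed.

End GrouseFacts.

(* Main.v *)
Require Import Defs.
From HB Require Import structures.
From mathcomp Require Import all_boot all_order all_algebra fingroup perm.
From mathcomp Require Import all_classical all_reals all_analysis.
From mathcomp Require Import measurable_realfun.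
From mathcomp Require Import ring lra.

(** Why the one-step bound holds.  Write A = Ubar^T U, M = A A^T, and let
    w = A^T s be the weight of the draw v = Ubar s.  With the step length
    eta = theta / sigma the rotation turns p / |p| exactly onto v / |v|, so the
    new basis is U + (v/|v| - p/|p|) (w/|w|)^T: the direction of w in U is
    replaced by v itself, which lies in the target subspace.  Multiplying by
    Ubar^T, the overlap A becomes A + (t - A u) u^T with unit vectors
    t = s/|s| and u = w/|w|; since this replaces the image of u by t, the
    squared Frobenius norm changes by exactly 1 - |A u|^2
    ([rank_one_update_gram]).  In terms of N = M - M^2 this is the identity
      eps_next = eps - (s^T N s) / (s^T M s)
    of [subspace_error_grouse_step], which with the convention x / 0 = 0 also
    covers the degenerate draws.

    Multiplication by U or Ubar preserves norms and by a transpose does not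
    increase them, so s^T N s = |w|^2 - |A w|^2 >= 0 and s^T M s = |w|^2 <= |s|^2.
    The decrease is therefore at least the Rayleigh quotient s^T N s / |s|^2.
    The law of a standard Gaussian vector is invariant under permutations and
    sign changes of the coordinates, hence E[s_i s_j / |s|^2] is 0 off the
    diagonal and 1/d on it, and the expected Rayleigh quotient is tr N / d
    ([expectation_rayleigh_quotient]).

    Finally N = B - B^2 with B = I - M, and B is the Gram matrix of the
    residuals of the columns of Ubar on the range of U.  Thus tr B = eps, and
    Cauchy-Schwarz gives tr B^2 <= (tr B)^2, so that tr N >= eps - eps^2
    ([tr_gain_mx_ge]).  The expected decrease is therefore at least
    (1 - eps) eps / d, which is stronger than (1 - 3 eps) eps / d. *)

Set Implicit Arguments.
Unset Strict Implicit.
Unset Printing Implicit Defensive.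

Import Order.TTheory GRing.Theory Num.Theory.

Local Open Scope classical_set_scope.
Local Open Scope ring_scope.

(** * Quadratic forms, Frobenius norms and Gram matrices *)

Section QuadraticForm.
Variables (R : realType) (d : nat).
Implicit Types (N : 'M[R]_d) (x y : 'cV[R]_d).

Definition quadratic_form N x : R := (x^T *m N *m x) 0 0.

Lemma quadratic_formB N N' x :
  quadratic_form (N - N') x = quadratic_form N x - quadratic_form N' x.
Proof. by rewrite /quadratic_form mulmxBr mulmxBl !mxE. Qed.

Lemma quadratic_form1 x : quadratic_form 1%:M x = euclidean_norm x ^+ 2.
Proof. by rewrite /quadratic_form mulmx1 sqr_euclidean_norm. Qed.

Lemma quadratic_form_gram m (A : 'M[R]_(m, d)) x :
  quadratic_form (A^T *m A) x = euclidean_norm (A *m x) ^+ 2.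
Proof. by rewrite sqr_euclidean_norm /quadratic_form trmx_mul !mulmxA. Qed.

Lemma quadratic_formE N x :
  quadratic_form N x = \sum_i \sum_j N i j * (x i 0 * x j 0).
Proof.
rewrite /quadratic_form mxE exchange_big/=; apply: eq_bigr => j _.
rewrite mxE big_distrl/=; apply: eq_bigr => i _.
by rewrite mxE; ring.
Qed.

End QuadraticForm.

Lemma sqr_frobenius_norm (R : realType) (m n : nat) (A : 'M[R]_(m, n)) :
  frobenius_norm A ^+ 2 = \tr (A *m A^T).
Proof.
rewrite sqr_sqrtr; last first.
  by rewrite sumr_ge0// => i _; rewrite sumr_ge0// => j _; exact: sqr_ge0.
apply: eq_bigr => i _; rewrite mxE; apply: eq_bigr => j _.
by rewrite mxE expr2.
Qed.

Lemma tr_outer (R : realType) (n : nat) (x : 'cV[R]_n) :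
  \tr (x *m x^T) = euclidean_norm x ^+ 2.
Proof. by rewrite mxtrace_mulC trace_mx11 sqr_euclidean_norm. Qed.

Lemma sqr_euclidean_normZ (R : realType) (n : nat) (c : R) (x : 'cV[R]_n) :
  euclidean_norm (c *: x) ^+ 2 = c ^+ 2 * euclidean_norm x ^+ 2.
Proof.
rewrite !sqr_euclidean_norm (_ : (c *: x)^T = c *: x^T); last exact: linearZ.
by rewrite -scalemxAl -scalemxAr scalerA mxE expr2.
Qed.

(** B agrees with A on the orthogonal complement of the unit vector u and maps u
    to t, so only the contribution of u to the Gram matrix of the rows
    changes. *)
Lemma rank_one_update_gram (R : realType) (m n : nat) (A : 'M[R]_(m, n))
    (t : 'cV[R]_m) (u : 'cV[R]_n) : u^T *m u = 1%:M ->
  let B := A + (t - A *m u) *m u^T in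
  B *m B^T = A *m A^T + (t *m t^T - (A *m u) *m (A *m u)^T).
Proof.
move=> uu; cbv zeta; move cE : (t - A *m u) => c.
have {cE}-> : t = A *m u + c by rewrite -cE addrC subrK.
rewrite 2![(_ + _)^T]linearD/= [(c *m _)^T]trmx_mul trmxK.
rewrite [(A *m u)^T]trmx_mul !mulmxDl !mulmxDr !mulmxA.
rewrite -[c *m u^T *m u]mulmxA uu mulmx1.
by rewrite -!addrA; congr (_ + _); rewrite [RHS]addrC -!addrA addNr addr0.
Qed.

Section Contraction.
Variables (R : realType) (n d : nat) (V : 'M[R]_(n, d)).
Hypothesis hV : orthonormal_columns V.

Lemma euclidean_norm_isometry (x : 'cV[R]_d) :
  euclidean_norm (V *m x) = euclidean_norm x.
Proof.
apply/eqP; rewrite -(@eqrXn2 _ 2) ?euclidean_norm_ge0//; apply/eqP.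
by rewrite -quadratic_form_gram hV quadratic_form1.
Qed.

Lemma euclidean_norm_contraction (x : 'cV[R]_n) :
  euclidean_norm (V^T *m x) ^+ 2 <= euclidean_norm x ^+ 2.
Proof.
rewrite (grouse_pythagoras x hV) /grouse_projection euclidean_norm_isometry.
by rewrite lerDl sqr_ge0.
Qed.

End Contraction.

(** The left-hand side is the sum of the squared inner products of the columns of
    C, each of which Cauchy-Schwarz bounds by a product of diagonal entries. *)
Lemma sum_sqr_gram_le (R : realType) (m n : nat) (C : 'M[R]_(m, n)) :
  \tr (C^T *m C *m (C^T *m C)) <= \tr (C^T *m C) ^+ 2.
Proof.
have cs (i j : 'I_n) : (\sum_k C k i * C k j) ^+ 2 <=
    (\sum_k C k i ^+ 2) * (\sum_k C k j ^+ 2).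
  (* Lagrange's identity *)
  have : 0 <= \sum_k \sum_l (C k i * C l j - C l i * C k j) ^+ 2.
    by rewrite sumr_ge0// => k _; rewrite sumr_ge0// => l _; exact: sqr_ge0.
  have -> : \sum_k \sum_l (C k i * C l j - C l i * C k j) ^+ 2 =
      2 * ((\sum_k C k i ^+ 2) * (\sum_k C k j ^+ 2)
           - (\sum_k C k i * C k j) ^+ 2).
    rewrite expr2 !big_distrl/= -sumrB big_distrr/=.
    rewrite [RHS](_ : _ = \sum_k \sum_l
        ((C k i ^+ 2 * C l j ^+ 2 - C k i * C k j * (C l i * C l j)) *+ 2)).
      transitivity (\sum_k \sum_l
        ((C k i ^+ 2 * C l j ^+ 2 - C k i * C k j * (C l i * C l j)) +
         (C l i ^+ 2 * C k j ^+ 2 - C k i * C k j * (C l i * C l j)))).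
        by apply: eq_bigr => k _; apply: eq_bigr => l _; ring.
      under eq_bigr do rewrite big_split.
      under [RHS]eq_bigr do under eq_bigr do rewrite mulr2n.
      under [RHS]eq_bigr do rewrite big_split.
      rewrite !big_split/=; congr (_ + _).
      rewrite exchange_big/=.
      by apply: eq_bigr => k _; apply: eq_bigr => l _; ring.
    apply: eq_bigr => k _; rewrite !big_distrr/= -sumrB big_distrr/=.
    by apply: eq_bigr => l _; ring.
  by rewrite pmulr_rge0// subr_ge0.
have E i j : (C^T *m C) i j = \sum_k C k i * C k j.
  by rewrite mxE; apply: eq_bigr => k _; rewrite mxE.
have D i : (C^T *m C) i i = \sum_k C k i ^+ 2.
  by rewrite E; apply: eq_bigr => k _; rewrite expr2.
rewrite /mxtrace expr2 big_distrl/=; apply: ler_sum => i _.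
rewrite mxE big_distrr/=; apply: ler_sum => j _.
have -> : (C^T *m C) j i = (C^T *m C) i j.
  by rewrite !E; apply: eq_bigr => k _; rewrite mulrC.
by rewrite -expr2 E !D cs.
Qed.

(** * The decrease of the subspace error in one step *)

Section ErrorDecrease.
Variables (R : realType) (n d : nat) (Ubar U : 'M[R]_(n, d)).
Hypotheses (hUbar : orthonormal_columns Ubar) (hU : orthonormal_columns U).

Definition overlap : 'M[R]_d := Ubar^T *m U.

(** Its eigenvalues are the squared cosines of the principal angles. *)
Definition overlap_gram : 'M[R]_d := overlap *m overlap^T.

(** Its eigenvalues cos^2 sin^2 measure how much a draw along each principal
    direction can gain: nothing for directions already found or orthogonal. *)
Definition gain_mx : 'M[R]_d := overlap_gram - overlap_gram *m overlap_gram.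

Local Notation A := overlap.
Local Notation M := overlap_gram.

Lemma subspace_errorE : subspace_error Ubar U = \tr (1%:M - M).
Proof. by rewrite raddfB/= mxtrace1 /subspace_error sqr_frobenius_norm. Qed.

(** I - U U^T is an orthogonal projection, so the matrix of inner products of
    the projected columns of Ubar is Ubar^T (I - U U^T) Ubar. *)
Lemma overlap_gram_compl :
  1%:M - M = (Ubar - U *m A^T)^T *m (Ubar - U *m A^T).
Proof.
rewrite [(_ - _)^T]raddfB/= trmx_mul trmxK mulmxBl !mulmxBr.
rewrite /M -{1}hUbar.
have -> : Ubar^T *m (U *m A^T) = A *m A^T by rewrite mulmxA.
have -> : A *m U^T *m Ubar = A *m A^T.
  by rewrite -mulmxA /A trmx_mul trmxK.
have -> : A *m U^T *m (U *m A^T) = A *m A^T.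
  by rewrite -mulmxA (mulmxA U^T) hU mul1mx.
by rewrite subrr subr0.
Qed.

(** In terms of B = I - M the gain is B - B^2, where tr B is the subspace error
    and tr B^2 <= (tr B)^2 because B is a Gram matrix. *)
Lemma tr_gain_mx_ge :
  subspace_error Ubar U - subspace_error Ubar U ^+ 2 <= \tr gain_mx.
Proof.
have -> : gain_mx = (1%:M - M) - (1%:M - M) *m (1%:M - M).
  rewrite /gain_mx mulmxBl mul1mx mulmxBr mulmx1 opprB addrA.
  by rewrite addrAC subrr add0r.
rewrite raddfB/= -subspace_errorE lerD2l lerN2 subspace_errorE.
by rewrite overlap_gram_compl sum_sqr_gram_le.
Qed.

Section Draw.
Variable s : 'cV[R]_d.

Local Notation v := (Ubar *m s).
Local Notation w := (grouse_weight U v).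

Lemma grouse_weight_overlap : w = A^T *m s.
Proof. by rewrite /grouse_weight /A trmx_mul trmxK mulmxA. Qed.

Lemma quadratic_form_overlap_gram :
  quadratic_form M s = euclidean_norm w ^+ 2.
Proof. by rewrite grouse_weight_overlap -quadratic_form_gram trmxK. Qed.

Lemma quadratic_form_gain_mx :
  quadratic_form gain_mx s =
  euclidean_norm w ^+ 2 - euclidean_norm (A *m w) ^+ 2.
Proof.
rewrite quadratic_formB quadratic_form_overlap_gram; congr (_ - _).
rewrite grouse_weight_overlap mulmxA -/overlap_gram -quadratic_form_gram.
by rewrite [M^T]trmx_mul trmxK.
Qed.

Lemma quadratic_form_gain_ge0 : 0 <= quadratic_form gain_mx s.
Proof.
rewrite quadratic_form_gain_mx subr_ge0 -(euclidean_norm_isometry hU w).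
by rewrite -mulmxA euclidean_norm_contraction.
Qed.

Lemma gain_le_overlap : quadratic_form gain_mx s <= quadratic_form M s.
Proof.
by rewrite quadratic_form_gain_mx quadratic_form_overlap_gram gerBl sqr_ge0.
Qed.

Lemma overlap_le_norm : quadratic_form M s <= euclidean_norm s ^+ 2.
Proof.
rewrite quadratic_form_overlap_gram -(euclidean_norm_isometry hUbar s).
exact: euclidean_norm_contraction.
Qed.

(** If s^T M s vanishes then so does the numerator, which is trapped between 0
    and s^T M s; hence the convention x / 0 = 0 does no harm here. *)
Lemma gain_ratio_ge :
  quadratic_form gain_mx s / euclidean_norm s ^+ 2 <=
  quadratic_form gain_mx s / quadratic_form M s.
Proof.
have [M0|M0] := eqVneq (quadratic_form M s) 0.
  have /eqP -> : quadratic_form gain_mx s == 0.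
    by rewrite eq_le quadratic_form_gain_ge0 andbT -M0 gain_le_overlap.
  by rewrite !mul0r.
have Mpos : 0 < quadratic_form M s.
  by rewrite lt_neqAle eq_sym M0 quadratic_form_overlap_gram sqr_ge0.
rewrite ler_wpM2l ?quadratic_form_gain_ge0// lef_pV2 ?posrE//.
  exact: overlap_le_norm.
exact: lt_le_trans overlap_le_norm.
Qed.

Lemma gain_ratio_itv :
  0 <= quadratic_form gain_mx s / quadratic_form M s <= 1.
Proof.
have M0 : 0 <= quadratic_form M s.
  by rewrite quadratic_form_overlap_gram sqr_ge0.
rewrite divr_ge0 ?quadratic_form_gain_ge0//=.
have [->|Mn0] := eqVneq (quadratic_form M s) 0; first by rewrite invr0 mulr0 ler01.
by rewrite ler_pdivrMr ?mul1r ?gain_le_overlap// lt_neqAle eq_sym Mn0.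
Qed.

(** The step length makes the rotation end on v / |v|, so that the overlap gets a
    rank-one update.  The degenerate draws fit the same formula: if p = 0 the
    denominator is 0, and if r = 0 then A w = s has the norm of w, so the
    numerator is 0. *)
Lemma subspace_error_grouse_step (eta : R) :
  (grouse_sigma U v != 0 -> eta = grouse_angle U v / grouse_sigma U v) ->
  subspace_error Ubar (grouse_step U v eta) =
  subspace_error Ubar U - quadratic_form gain_mx s / quadratic_form M s.
Proof.
set p := grouse_projection U v; set r := grouse_residual U v.
have pw : euclidean_norm p = euclidean_norm w by rewrite euclidean_norm_isometry.
have vs : euclidean_norm v = euclidean_norm s by rewrite euclidean_norm_isometry.
move=> heta; rewrite /grouse_step; case: ifPn => [|s0].
  rewrite /grouse_sigma mulf_eq0 => /orP[/eqP r0|/eqP p0]; last first.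
    rewrite quadratic_form_overlap_gram -pw p0 expr0n/= invr0 mulr0 subr0//.
  have vp : v = p.
    by apply/eqP; rewrite -subr_eq0; apply/eqP; exact: euclidean_norm_eq0 r0.
  have Aw : A *m w = s.
    rewrite /A -mulmxA -[U *m w]/p -vp mulmxA hUbar mul1mx//.
  by rewrite quadratic_form_gain_mx Aw -vs -pw -vp subrr mul0r subr0.
rewrite (heta s0) [grouse_sigma _ _ * _]mulrC divfK//.
move: s0; rewrite /grouse_sigma mulf_eq0 negb_or -/p -/r => /andP[r0 p0].
have v0 : v != 0.
  apply: contra p0 => /eqP v0.
  rewrite /p /grouse_projection /grouse_weight v0 !mulmx0.
  rewrite /euclidean_norm big1 ?sqrtr0//.
  by move=> i _; rewrite mxE expr0n.
have nv0 : euclidean_norm v != 0.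
  by apply: contra v0 => /eqP /euclidean_norm_eq0 ->.
rewrite cos_grouse_angle// sin_grouse_angle// -/p -/r.
have -> : ((euclidean_norm p / euclidean_norm v - 1) / euclidean_norm p) *: p +
    (euclidean_norm r / euclidean_norm v / euclidean_norm r) *: r =
    (euclidean_norm v)^-1 *: v - (euclidean_norm p)^-1 *: p.
  have -> : (euclidean_norm p / euclidean_norm v - 1) / euclidean_norm p =
      (euclidean_norm v)^-1 - (euclidean_norm p)^-1.
    by field; rewrite ?nv0 ?p0 ?r0.
  have -> : euclidean_norm r / euclidean_norm v / euclidean_norm r =
      (euclidean_norm v)^-1.
    by field; rewrite ?nv0 ?p0 ?r0.
  rewrite scalerBl addrAC -scalerDr.
  by rewrite [p + r]addrC /r /grouse_residual subrK.
pose u := (euclidean_norm w)^-1 *: w.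
have w0 : euclidean_norm w != 0 by rewrite -pw.
have uu : u^T *m u = 1%:M.
  rewrite [LHS]mx11_scalar -sqr_euclidean_norm sqr_euclidean_normZ.
  by rewrite -exprMn mulVf ?expr1n.
pose t := (euclidean_norm s)^-1 *: s.
rewrite /subspace_error !sqr_frobenius_norm.
have -> : Ubar^T *m
    (U + ((euclidean_norm v)^-1 *: v - (euclidean_norm p)^-1 *: p)
    *m ((euclidean_norm w)^-1 *: w^T)) = A + (t - A *m u) *m u^T.
  rewrite mulmxDr mulmxA mulmxBr -!scalemxAr (mulmxA Ubar^T Ubar) hUbar mul1mx.
  rewrite vs pw (mulmxA Ubar^T U) -/A /t /u.
  congr (_ + _); rewrite scalemxAr; congr (_ *m _).
  by apply/esym; exact: linearZ.
rewrite -/A.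
rewrite rank_one_update_gram// raddfD raddfB/= !tr_outer.
rewrite sqr_euclidean_normZ -exprMn -vs mulVf//.
rewrite expr1n quadratic_form_gain_mx quadratic_form_overlap_gram.
rewrite /u -scalemxAr sqr_euclidean_normZ.
by field.
Qed.
End Draw.
End ErrorDecrease.

(** * The law of a finite family of real random variables *)

Section LawOnTuples.
Context {disp : measure_display} {T : measurableType disp} {R : realType}.
Variables (P : probability T R) (n : nat).
Implicit Types X Y : 'I_n -> T -> R.

Definition box (B : 'I_n -> set R) : set (n.-tuple R) :=
  [set t | forall i, B i (tnth t i)].

Definition boxes : set (set (n.-tuple R)) :=
  [set C | exists2 B : 'I_n -> set R, (forall i, measurable (B i)) & C = box B].

(** The boxes form a pi-system, which makes them a determining class. *)
Lemma setI_closed_boxes : setI_closed boxes.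
Proof.
move=> _ _ [B mB ->] [C mC ->]; exists (fun i => B i `&` C i).
  by move=> i; exact: measurableI.
apply/seteqP; split=> t /=.
  by move=> [tB tC] i; split; [exact: tB|exact: tC].
by move=> tBC; split=> i; have [] := tBC i.
Qed.

Lemma measurable_box (B : 'I_n -> set R) :
  (forall i, measurable (B i)) -> measurable (box B).
Proof.
move=> mB; rewrite (_ : box B = \bigcap_(i in [set: 'I_n])
    ((@tnth _ R ^~ i) @^-1` B i)); last first.
  by apply/seteqP; split=> t /= tB i; [move=> _; exact: tB|exact: tB].
apply: fin_bigcap_measurable => [|i _]; first exact: finite_finset.
by rewrite -[X in measurable X]setTI; exact: measurable_tnth.
Qed.

Lemma measurable_tuple_boxes :
  (measurable : set (set (n.-tuple R))) = <<s boxes >>.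
Proof.
apply/seteqP; split.
  apply: smallest_sub; first exact: smallest_sigma_algebra.
  move=> A; rewrite -bigcup_seq/= => -[i _ [B mB <-]].
  apply: sub_sigma_algebra; exists (fun j => if j == i then B else setT).
    by move=> j; case: ifP.
  rewrite setTI; apply/seteqP; split=> t /=.
    by move=> tB j; case: eqP => // ->.
  by move=> /(_ i); rewrite eqxx.
apply: smallest_sub; first exact: sigma_algebra_measurable.
by move=> _ [B mB ->]; exact: measurable_box.
Qed.

Definition random_tuple X (omega : T) : n.-tuple R := [tuple X i omega | i < n].

Lemma measurable_random_tuple X :
  (forall i, measurable_fun [set: T] (X i)) ->
  measurable_fun [set: T] (random_tuple X).
Proof.
move=> mX; apply/measurable_fun_tnthP => i.
by apply: eq_measurable_fun (mX i) => omega _; rewrite /= tnth_mktuple.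
Qed.

(** The two push-forward measures on tuples agree on the boxes, hence on the
    sigma-algebra that these generate, hence they integrate f alike. *)
Lemma eq_law_integral X Y (f : n.-tuple R -> \bar R) :
  (forall i, measurable_fun [set: T] (X i)) ->
  (forall i, measurable_fun [set: T] (Y i)) ->
  (forall B : 'I_n -> set R, (forall i, measurable (B i)) ->
    P (\bigcap_(i in [set: 'I_n]) (X i @^-1` B i)) =
    P (\bigcap_(i in [set: 'I_n]) (Y i @^-1` B i))) ->
  measurable_fun [set: n.-tuple R] f ->
  P.-integrable [set: T] (f \o random_tuple X) ->
  P.-integrable [set: T] (f \o random_tuple Y) ->
  (\int[P]_x f (random_tuple X x) = \int[P]_x f (random_tuple Y x))%E.
Proof.
move=> mX mY XY mf iX iY.
have mrX := measurable_random_tuple mX.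
have mrY := measurable_random_tuple mY.
transitivity (\int[pushforward P (random_tuple X)]_t f t)%E.
  by rewrite integral_pushforward.
transitivity (\int[pushforward P (random_tuple Y)]_t f t)%E; last first.
  by rewrite integral_pushforward.
apply: eq_measure_integral => A mA _.
apply: (measure_unique boxes (fun _ => setT)) => //.
- exact: measurable_tuple_boxes.
- exact: setI_closed_boxes.
- by move=> _; exists (fun=> setT) => //; apply/seteqP; split.
- exact: bigcup_const.
- move=> _ [B mB ->]; have E Z : random_tuple Z @^-1` box B =
      \bigcap_(i in [set: 'I_n]) (Z i @^-1` B i).
    apply/seteqP; split=> x /=.
      by move=> ZB i _; have := ZB i; rewrite tnth_mktuple.
    by move=> ZB i; rewrite tnth_mktuple; exact: ZB.
  by rewrite /= /pushforward !E XY.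
- by move=> _; rewrite /= /pushforward preimage_setT probability_setT ltry.
Qed.

End LawOnTuples.

Lemma measurable_fun_div_ge0 (disp : measure_display) (T : measurableType disp)
    (R : realType) (f g : T -> R) : (forall x, 0 <= g x) ->
  measurable_fun [set: T] f -> measurable_fun [set: T] g ->
  measurable_fun [set: T] (fun x => f x / g x).
Proof.
(* on nonnegative reals, 0 included, inversion is the power of exponent -1 *)
move=> g0 mf mg.
have -> : (fun x => f x / g x) = f \* (fun x => g x `^ (-1)).
  by apply/funext => x /=; rewrite powR_inv1.
apply: measurable_funM => //.
exact: (measurableT_comp (measurable_powR _) mg).
Qed.

Lemma bounded_integrable (disp : measure_display)
    (T : measurableType disp) (R : realType) (P : probability T R)
    (f : T -> R) (K : R) : measurable_fun [set: T] f ->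
  (forall x, `|f x| <= K) -> P.-integrable [set: T] (EFin \o f).
Proof.
move=> mf fK; apply: measurable_bounded_integrable => //.
  exact: le_lt_trans (probability_le1 P measurableT) (ltry 1).
exists K; split; first exact: num_real.
by move=> M KM x _; exact: le_trans (fK x) (ltW KM).
Qed.

(** * Symmetries of a standard Gaussian vector *)

(** The density is even and Lebesgue measure is invariant under reflection. *)
Lemma standard_normal_prob_opp (R : realType) (B : set R) : measurable B ->
  normal_prob 0 1 (-%R @^-1` B) = normal_prob 0 1 B.
Proof.
move=> mB; rewrite /normal_prob.
have evenf (x : R) : normal_pdf 0 1 (- x) = normal_pdf 0 1 x :> R.
  by rewrite /normal_pdf oner_eq0 /normal_fun !subr0 sqrrN.
have mf : measurable_fun B (fun x : R => (normal_pdf 0 1 x)%:E).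
  by apply/measurable_EFinP; apply: measurable_funTS; exact: measurable_normal_pdf.
transitivity (\int[pushforward lebesgue_measure
    (-%R : R -> measurableTypeR R)]_(x in B) (normal_pdf 0 1 x)%:E)%E; last first.
  by apply: eq_measure_integral => A mA _; exact: lebesgue_measureN.
rewrite ge0_integral_pushforward//; last first.
  by move=> x _; rewrite lee_fin normal_pdf_ge0.
by apply: eq_integral => x _ /=; rewrite evenf.
Qed.

Section GaussianSymmetry.
Context {disp : measure_display} {T : measurableType disp} {R : realType}.
Variables (P : probability T R) (d : nat) (s : 'I_d -> {RV P >-> R}).
Hypothesis hs : iid_standard_normal s.

(** Permuting the coordinates of an i.i.d. Gaussian family and applying to each
    of them a map that preserves the Gaussian law leaves the joint law
    unchanged; its value on a box is again the product of the marginals. *)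
Lemma iid_standard_normal_perm_map (pi : {perm 'I_d}) (g : 'I_d -> R -> R)
    (B : 'I_d -> set R) :
  (forall i, measurable_fun [set: R] (g i)) ->
  (forall i (C : set R), measurable C ->
    normal_prob 0 1 (g i @^-1` C) = normal_prob 0 1 C) ->
  (forall i, measurable (B i)) ->
  P (\bigcap_(i in [set: 'I_d]) ((g i \o s (pi i)) @^-1` B i)) =
  (\prod_i normal_prob 0 1 (B i))%E.
Proof.
move=> mg gN mB.
pose C j := g (pi^-1 j)%g @^-1` B (pi^-1 j)%g.
have mC j : measurable (C j).
  by rewrite /C -[X in measurable X]setTI; exact: mg.
have := hs.1 [set: 'I_d]%SET C mC.
rewrite (_ : \bigcap_(i in [set` _]) _ =
    \bigcap_(i in [set: 'I_d]) ((g i \o s (pi i)) @^-1` B i)); last first.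
  apply/seteqP; split=> x /= sx i _.
    by have := sx (pi i); rewrite /C permK; apply; rewrite /= inE.
  by have := sx (pi^-1 i)%g Logic.I; rewrite /C/= permKV.
move=> ->; rewrite big_mkcond/= [RHS](reindex_perm (pi^-1)%g)/=.
apply: eq_bigr => j _; rewrite inE -(gN (pi^-1 j)%g)//.
exact: hs.2.
Qed.

(** Entry (i, j) of the projection onto the line of x, equal to 0 for x = 0. *)
Definition direction_product (x : 'I_d -> R) (i j : 'I_d) : R :=
  x i * x j / \sum_k x k ^+ 2.

Lemma direction_product_le1 x i j : `|direction_product x i j| <= 1.
Proof.
have S0 : 0 <= \sum_k x k ^+ 2 by rewrite sumr_ge0// => k _; exact: sqr_ge0.
have le_S k : x k ^+ 2 <= \sum_k x k ^+ 2.
  by rewrite (bigD1 k)//= lerDl sumr_ge0// => l _; exact: sqr_ge0.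
have [S00|Sn0] := eqVneq (\sum_k x k ^+ 2) 0.
  by rewrite /direction_product S00 invr0 mulr0 normr0 ler01.
rewrite normrM normfV (ger0_norm S0).
rewrite ler_pdivrMr ?lt_neqAle ?S0 ?andbT 1?eq_sym//.
rewrite mul1r ler_norml; have := le_S i; have := le_S j.
have := sqr_ge0 (x i - x j); have := sqr_ge0 (x i + x j).
by move=> ? ? ? ?; apply/andP; split; nra.
Qed.

Lemma measurable_direction_product (disp' : measure_display)
    (T' : measurableType disp') (X : 'I_d -> T' -> R) i j :
  (forall k, measurable_fun [set: T'] (X k)) ->
  measurable_fun [set: T'] (fun omega => direction_product (X ^~ omega) i j).
Proof.
move=> mX; apply: measurable_fun_div_ge0.
- by move=> x; rewrite sumr_ge0// => k _; exact: sqr_ge0.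
- exact: measurable_funM.
- by apply: measurable_sum => k; exact: measurable_funX.
Qed.

Lemma integrable_direction_product (X : 'I_d -> T -> R) i j :
  (forall k, measurable_fun [set: T] (X k)) ->
  P.-integrable [set: T]
    (EFin \o (fun omega => direction_product (X ^~ omega) i j)).
Proof.
move=> mX; apply: (@bounded_integrable _ _ _ _ _ 1).
  exact: measurable_direction_product.
by move=> omega; exact: direction_product_le1.
Qed.

Local Notation moment i j :=
  (\int[P]_omega (direction_product (fun k => s k omega) i j)%:E)%E.

(** Signed permutations preserve both the joint law and the Euclidean norm in the
    denominator. *)
Lemma direction_moment_sym (pi : {perm 'I_d}) (c : 'I_d -> bool) i j :
  moment i j = (((-1) ^+ c i * (-1) ^+ c j)%:E * moment (pi i) (pi j))%E.
Proof.
pose X k : T -> R := s k.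
pose Y k : T -> R := fun omega => (-1) ^+ c k * s (pi k) omega.
have mX k : measurable_fun [set: T] (X k) by [].
have mY k : measurable_fun [set: T] (Y k) by exact: measurable_funM.
pose f (t : d.-tuple R) := (direction_product (tnth t) i j)%:E.
have fE Z omega :
    f (random_tuple Z omega) = (direction_product (Z ^~ omega) i j)%:E.
  congr (direction_product _ _ _)%:E; apply/funext => k.
  by rewrite tnth_mktuple.
have mf : measurable_fun [set: d.-tuple R] f.
  apply/measurable_EFinP.
  apply: (@measurable_direction_product _ _ (fun k t => tnth t k)).
  by move=> k; exact: measurable_tnth.
have int_f Z : (forall k, measurable_fun [set: T] (Z k)) ->
    P.-integrable [set: T] (f \o random_tuple Z).
  move=> mZ; have := integrable_direction_product i j mZ.
  by apply: eq_integrable => // omega _; rewrite /= fE.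
transitivity (\int[P]_omega f (random_tuple Y omega))%E; last first.
  rewrite -integralZl//; last exact: integrable_direction_product.
  apply: eq_integral => omega _; rewrite fE -EFinM; congr EFin.
  rewrite /direction_product /Y [in RHS](reindex_perm pi) /=.
  under eq_bigr do rewrite exprMn sqrr_sign mul1r.
  by ring.
transitivity (\int[P]_omega f (random_tuple X omega))%E.
  by apply: eq_integral => omega _; rewrite fE.
apply: eq_law_integral => //; [|exact: int_f|exact: int_f].
move=> B mB.
transitivity (\prod_k normal_prob 0 1 (B k))%E.
  rewrite -(@iid_standard_normal_perm_map 1%g (fun=> id) B)//.
  by congr (P _); apply: eq_bigcapr => k _; rewrite perm1.
pose g k : R -> R := if c k then -%R else id.
rewrite -(@iid_standard_normal_perm_map pi g B)//.
- congr (P _); apply: eq_bigcapr => k _; apply/seteqP.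
  by rewrite /Y/= /g; case: (c k); split=> omega /=; rewrite ?mulN1r ?mul1r.
- by move=> k; rewrite /g; case: (c k); [exact: measurable_funN|].
- by move=> k C mC; rewrite /g; case: (c k) => //; exact: standard_normal_prob_opp.
Qed.

(** Flipping the sign of the i-th coordinate alone negates the moment. *)
Lemma direction_moment_offdiag i j : i != j -> moment i j = 0%E.
Proof.
move=> ij; have fin : moment i j \is a fin_num.
  by apply: integrable_fin_num => //; exact: integrable_direction_product.
have := direction_moment_sym 1%g (pred1 i) i j.
rewrite !perm1 /= eqxx eq_sym (negbTE ij) expr1 expr0 mulr1.
by rewrite -(fineK fin) -EFinM => -[] ?; congr EFin; lra.
Qed.

(** The d diagonal moments agree by exchangeability, and they add up to 1 because
    s is almost surely nonzero. *)
Lemma direction_moment_diag i : moment i i = (d%:R^-1)%:E.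
Proof.
have fin k : moment k k \is a fin_num.
  by apply: integrable_fin_num => //; exact: integrable_direction_product.
have same k : moment k k = moment i i.
  rewrite (direction_moment_sym (tperm k i) xpred0) !tpermL /=.
  by rewrite expr0 mulr1 mul1e.
have d0 : (d%:R : R) != 0.
  by rewrite pnatr_eq0 -lt0n (leq_ltn_trans _ (ltn_ord i)).
have sum1 : (\sum_(k < d) moment k k = 1)%E.
  rewrite -integral_sum//; last first.
    by move=> k; exact: integrable_direction_product.
  transitivity (\int[P]_omega (cst 1 omega))%E; last first.
    by rewrite integral_cst// mul1e; exact: probability_setT.
  apply: ae_eq_integral => //.
  - apply: emeasurable_sum => k; apply/measurable_EFinP.
    exact: measurable_direction_product.
  (* the exceptional null set can be enlarged from s = 0 to s_i = 0 *)
  - exists (s i @^-1` [set 0]); split.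
    + by rewrite -[X in measurable X]setTI; exact: measurable_funPT.
    + have := hs.2 i [set 0] (measurable_set1 _).
      by rewrite /normal_prob integral_set1; exact.
    + move=> omega /= h; apply: contra_notP h => /eqP s0 _.
      rewrite sumEFin -mulr_suml; congr EFin.
      under eq_bigr do rewrite -expr2.
      rewrite divff// gt_eqF// (bigD1 i)//= ltr_pwDl ?exprn_even_gt0//.
      by rewrite sumr_ge0// => k _; exact: sqr_ge0.
apply/eqP; rewrite -(fineK (fin i)); apply/eqP; congr EFin.
apply: (mulfI d0); rewrite mulfV//.
have := sum1; under eq_bigr do rewrite same -(fineK (fin i)).
by rewrite sumEFin sumr_const card_ord mulr_natl => -[].
Qed.

End GaussianSymmetry.

(** * The expected Rayleigh quotient and the theorem *)

Section RandomDirection.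
Context {disp : measure_display} {T : measurableType disp} {R : realType}.
Variables (P : probability T R) (d : nat) (s : 'I_d -> {RV P >-> R}).

Local Notation S omega := (\col_(i < d) s i omega).

Lemma measurable_quadratic_form (N : 'M[R]_d) :
  measurable_fun [set: T] (fun omega => quadratic_form N (S omega)).
Proof.
under eq_fun do rewrite quadratic_formE.
apply: measurable_sum => i; apply: measurable_sum => j.
under eq_fun do rewrite !mxE.
by apply: measurable_funM => //; exact: measurable_funM.
Qed.

Lemma rayleigh_quotientE (N : 'M[R]_d) omega :
  quadratic_form N (S omega) / euclidean_norm (S omega) ^+ 2 =
  \sum_i \sum_j N i j * direction_product (fun k => s k omega) i j.
Proof.
rewrite quadratic_formE sqr_sqrtr; last first.
  by rewrite sumr_ge0// => k _; exact: sqr_ge0.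
rewrite mulr_suml; apply: eq_bigr => i _.
rewrite mulr_suml; apply: eq_bigr => j _.
rewrite !mxE -mulrA; congr (_ * (_ / _)).
by apply: eq_bigr => k _; rewrite mxE.
Qed.

Let int_term (N : 'M[R]_d) i j : P.-integrable [set: T]
  (fun omega => (N i j * direction_product (fun k => s k omega) i j)%:E).
Proof.
under eq_fun do rewrite EFinM.
by apply: integrableZl => //; exact: integrable_direction_product.
Qed.

Let integral_term (N : 'M[R]_d) i j :
  (\int[P]_omega (N i j * direction_product (fun k => s k omega) i j)%:E =
   (N i j)%:E * \int[P]_omega (direction_product (fun k => s k omega) i j)%:E)%E.
Proof.
under eq_integral do rewrite EFinM.
by rewrite integralZl//; exact: integrable_direction_product.
Qed.

Lemma integrable_rayleigh_quotient (N : 'M[R]_d) : P.-integrable [set: T]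
  (fun omega => (quadratic_form N (S omega) / euclidean_norm (S omega) ^+ 2)%:E).
Proof.
under eq_fun do rewrite rayleigh_quotientE -sumEFin.
apply: integrable_sum => // i _; under eq_fun do rewrite -sumEFin.
by apply: integrable_sum => // j _; exact: int_term.
Qed.

(** The quotient is linear in N, with coefficients whose means are the moments
    above: only the diagonal ones survive, and each equals 1/d. *)
Lemma expectation_rayleigh_quotient (N : 'M[R]_d) : iid_standard_normal s ->
  (\int[P]_omega (quadratic_form N (S omega) / euclidean_norm (S omega) ^+ 2)%:E
   = (\tr N / d%:R)%:E)%E.
Proof.
move=> hs.
under eq_integral do rewrite rayleigh_quotientE -sumEFin.
rewrite integral_sum//; last first.
  move=> i; under eq_fun do rewrite -sumEFin.
  by apply: integrable_sum => // j _; exact: int_term.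
rewrite /mxtrace mulr_suml -sumEFin; apply: eq_bigr => i _.
under eq_integral do rewrite -sumEFin.
rewrite integral_sum//.
rewrite (bigD1 i)//= big1 => [|j ji].
  by rewrite adde0 integral_term (direction_moment_diag hs).
by rewrite integral_term (direction_moment_offdiag hs) 1?eq_sym// mule0.
Qed.

End RandomDirection.

Theorem theorem3p2 (R : realType) (n d : nat) (hd : (0 < d)%N) (hdn : (d < n)%N)
  (Ubar U : 'M[R]_(n, d))
  (hUbar : orthonormal_columns Ubar) (hU : orthonormal_columns U)
  (disp : measure_display) (T : measurableType disp) (P : probability T R)
  (s : 'I_d -> {RV P >-> R}) (hs : iid_standard_normal s)
  (v : T -> 'cV[R]_n)
  (hv : forall omega, v omega = Ubar *m (\col_(i < d) s i omega))
  (eta : T -> R)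
  (heta : forall omega, grouse_sigma U (v omega) != 0 ->
     eta omega = grouse_angle U (v omega) / grouse_sigma U (v omega))
  (epsbar : R) (hepsbar : 0 < epsbar < 1 / 3)
  (heps : subspace_error Ubar U <= epsbar) :
  ('E_P[fun omega => subspace_error Ubar (grouse_step U (v omega) (eta omega))]
   <= ((1 - (1 - 3 * subspace_error Ubar U) / d%:R)
       * subspace_error Ubar U)%:E)%E.
Proof.
pose S omega : 'cV[R]_d := \col_(i < d) s i omega.
pose N := gain_mx Ubar U; pose M := overlap_gram Ubar U.
set eps := subspace_error Ubar U.
have step omega : subspace_error Ubar (grouse_step U (v omega) (eta omega)) =
    eps - quadratic_form N (S omega) / quadratic_form M (S omega).
  by rewrite hv subspace_error_grouse_step// -hv; exact: heta.
rewrite unlock; under eq_integral do rewrite step.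
have int_ray := integrable_rayleigh_quotient s N.
have int_eps : P.-integrable [set: T] (EFin \o cst eps).
  exact: finite_measure_integrable_cst.
apply: (@le_trans _ _ (\int[P]_omega (eps -
    quadratic_form N (S omega) / euclidean_norm (S omega) ^+ 2)%:E)%E).
  apply: le_integral => //.
  - apply: (@bounded_integrable _ _ _ _ _ (`|eps| + 1)) => [|omega].
      apply: measurable_funB => //; apply: measurable_fun_div_ge0.
      + by move=> omega; rewrite quadratic_form_overlap_gram sqr_ge0.
      + exact: measurable_quadratic_form.
      + exact: measurable_quadratic_form.
    rewrite (le_trans (ler_normB _ _))// lerD2l.
    have /andP[r0 r1] := gain_ratio_itv hUbar hU (S omega).
    by rewrite [X in X <= _]ger0_norm.
  - by under eq_fun do rewrite EFinB; exact: integrableB.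
  - by move=> omega _; rewrite lee_fin lerD2l lerN2 gain_ratio_ge.
under eq_integral do rewrite EFinB.
have := expectation_cst P eps; rewrite unlock => int_cst.
rewrite integralB_EFin// int_cst expectation_rayleigh_quotient//.
rewrite -EFinB lee_fin.
have d0 : 0 < d%:R^-1 :> R by rewrite invr_gt0 ltr0n.
have := tr_gain_mx_ge hUbar hU; rewrite -/N -/eps => trN.
have -> : (1 - (1 - 3 * eps) / d%:R) * eps = eps - (eps - 3 * eps ^+ 2) / d%:R.
  ring.
rewrite lerD2l lerN2 ler_pM2r//.
by apply: le_trans trN; rewrite lerD2l lerN2; have := sqr_ge0 eps; lra.
Qed.
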